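(* Let $(\mathcal{S},\mathcal{A},p,\mu_0,\gamma)$ be a finite discounted Markov decision process setting (without reward), let $d$ be a metric on $\mathcal{S}\times\mathcal{A}$, let $\pi_E\in\Pi$ be an expert policy with occupancy measure $\rho_E:=\rho_{\pi_E}$, and let $\mathcal{B}$ be the set of measures on $\mathcal{S}\times\mathcal{A}$ satisfying the Bellman equation. Define the cost regularizer $$\psi(c)=\sup_{\rho\in\mathcal{B}}\;\langle c,\rho-\rho_E\rangle-W_d(\rho,\rho_E),\qquad c:\mathcal{S}\times\mathcal{A}\to\mathbb{R}.$$ Then its convex conjugate $\psi^*$ satisfies $$\psi^*(\rho_\pi-\rho_E)=W_d(\rho_\pi,\rho_E)\qquad\text{for all }\pi\in\Pi.$$ Moreover, the inverse reinforcement learning problem $$\mathrm{IRL}_\psi(\pi_E)=\operatorname*{arg\,max}_{c:\mathcal{S}\times\mathcal{A}\to\mathbb{R}}\;-\psi(c)+\Big(\min_{\pi\in\Pi}-H(\pi)+\langle c,\rho_\pi\rangle\Big)-\langle c,\rho_E\rangle$$ becomes $$\mathrm{IRL}_\psi(\pi_E)=\operatorname*{arg\,max}_{c:\mathcal{S}\times\mathcal{A}\to\mathbb{R}}\;\Big(\inf_{\rho\in\mathcal{B}}W_d(\rho,\rho_E)-\langle c,\rho\rangle\Big)+\Big(\min_{\pi\in\Pi}-H(\pi)+\langle c,\rho_\pi\rangle\Big).$$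
   Context: Setting: $\mathcal{S}$ and $\mathcal{A}$ are finite (nonempty) sets of states and actions; $p(\cdot\mid s,a)$ is a probability measure on $\mathcal{S}$ for every $(s,a)\in\mathcal{S}\times\mathcal{A}$; $\mu_0$ is a probability measure on $\mathcal{S}$ with $\mu_0(s)>0$ for all $s$; $\gamma\in(0,1)$. $\Pi$ is the set of stochastic policies, i.e. maps assigning to each $s\in\mathcal{S}$ a probability distribution $\pi(\cdot\mid s)$ on $\mathcal{A}$. Occupancy measure: for $\pi\in\Pi$, $\rho_\pi(s,a)=(1-\gamma)\,\pi(a\mid s)\sum_{t=0}^\infty\gamma^t\,\mathbb{P}[S_t=s]$, where $(S_t,A_t)_{t\ge 0}$ is the chain with $S_0\sim\mu_0$, $A_t\sim\pi(\cdot\mid S_t)$, $S_{t+1}\sim p(\cdot\mid S_t,A_t)$. It is a probability measure on $\mathcal{S}\times\mathcal{A}$. Bellman equation: $\mathcal{B}$ is the set of (nonnegative) measures $\rho$ on $\mathcal{S}\times\mathcal{A}$ with $\sum_{a'\in\mathcal{A}}\rho(s',a')=(1-\gamma)\mu_0(s')+\gamma\sum_{(s,a)\in\mathcal{S}\times\mathcal{A}}p(s'\mid s,a)\rho(s,a)$ for all $s'\in\mathcal{S}$. It is known that every element of $\mathcal{B}$ is a probability measure and that $\pi\mapsto\rho_\pi$ is a bijection from $\Pi$ onto $\mathcal{B}$, with inverse $\pi_\rho(a\mid s)=\rho(s,a)/\sum_{a'}\rho(s,a')$. Notation: $\langle c,\rho\rangle=\sum_{(s,a)\in\mathcal{S}\times\mathcal{A}}c(s,a)\rho(s,a)$.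 The causal entropy is $H(\pi)=\frac{1}{1-\gamma}\,\mathbb{E}_{(s,a)\sim\rho_\pi}[-\log\pi(a\mid s)]$ (with $0\log 0=0$). For probability measures $\mu,\nu$ on $\mathcal{S}\times\mathcal{A}$, $W_d(\mu,\nu)=\min_\kappa\sum_{x,y}d(x,y)\kappa(x,y)$ is the 1-Wasserstein distance with ground cost $d$, the minimum being over all couplings $\kappa$ of $\mu$ and $\nu$; equivalently, it is the supremum of $\langle r,\nu\rangle-\langle r,\mu\rangle$ over functions $r:\mathcal{S}\times\mathcal{A}\to\mathbb{R}$ that are 1-Lipschitz with respect to $d$. The convex conjugate of $\psi:\mathbb{R}^{\mathcal{S}\times\mathcal{A}}\to\mathbb{R}$ is $\psi^*(x)=\sup_{c\in\mathbb{R}^{\mathcal{S}\times\mathcal{A}}}\langle c,x\rangle-\psi(c)$. *)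

(* Defs.v *)
From mathcomp Require Export all_boot all_order all_algebra.
From mathcomp Require Export all_classical all_reals all_analysis.

Set Implicit Arguments.
Unset Strict Implicit.
Unset Printing Implicit Defensive.

Export Order.TTheory GRing.Theory Num.Theory.
Export numFieldNormedType.Exports.

Local Open Scope classical_set_scope.
Local Open Scope ring_scope.

Definition is_prob (R : realType) (T : finType) (f : T -> R) : Prop :=
  (forall x, 0 <= f x) /\ \sum_x f x = 1.

Definition is_metric (R : realType) (T : Type) (d : T -> T -> R) : Prop :=
  [/\ forall x y, 0 <= d x y,
      forall x y, d x y = 0 <-> x = y,
      forall x y, d x y = d y x &
      forall x y z, d x z <= d x y + d y z].

(* The least element of E; the default value 0 is only reached if E has none. *)
Definition minimum (R : realType) (E : set R) : R := xget 0 (E `&` lbound E).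

Definition argmax (R : realType) (X : Type) (F : X -> R) : set X :=
  [set x | forall y, F y <= F x].

Definition pairing (R : realType) (T : finType) (c x : T -> R) : R :=
  \sum_z c z * x z.

(* Convex conjugate; it is +oo outside its effective domain, hence \bar R. *)
Definition conjugate (R : realType) (T : finType) (psi : (T -> R) -> R)
    (x : T -> R) : \bar R :=
  ereal_sup (range (fun c : T -> R => (pairing c x - psi c)%:E)).

Definition couplings (R : realType) (T : finType) (mu nu : T -> R) :
    set (T -> T -> R) :=
  [set kappa | [/\ forall x y, 0 <= kappa x y,
                   forall x, \sum_y kappa x y = mu x &
                   forall y, \sum_x kappa x y = nu y]].

Definition wasserstein (R : realType) (T : finType) (d : T -> T -> R)
    (mu nu : T -> R) : R :=
  minimum [set \sum_x \sum_y d x y * kappa x y | kappa in couplings mu nu].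

Record mdp (R : realType) (S A : finType) := MDP {
  trans : S -> A -> S -> R;  (* trans s a s' is p(s' | s, a) *)
  init : S -> R;
  disc : R;
  states_gt0 : (0 < #|S|)%N;
  actions_gt0 : (0 < #|A|)%N;
  trans_prob : forall s a, is_prob (trans s a);
  init_prob : is_prob init;
  init_gt0 : forall s, 0 < init s;
  disc_gt0_lt1 : 0 < disc < 1
}.

(* pi s a is pi(a | s). *)
Definition policies {R : realType} {S A : finType} : set (S -> A -> R) :=
  [set pi | forall s, is_prob (pi s)].

Section MDP.
Context (R : realType) (S A : finType) (M : mdp R S A).
Implicit Types (pi : S -> A -> R) (rho c : S * A -> R).

(* Joint law of ((S_0, A_0), ..., (S_t, A_t)) under pi. *)
Definition traj_prob pi t (h : {ffun 'I_t.+1 -> S * A}) : R :=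
  init M (h ord0).1
  * \prod_(i < t.+1) pi (h i).1 (h i).2
  * \prod_(i < t) trans M (h (widen_ord (leqnSn t) i)).1
                          (h (widen_ord (leqnSn t) i)).2
                          (h (lift ord0 i)).1.

(* P[S_t = s], as a marginal of the joint law. *)
Definition state_prob pi t (s : S) : R :=
  \sum_(h : {ffun 'I_t.+1 -> S * A} | (h ord_max).1 == s) traj_prob pi h.

Definition occupancy pi : S * A -> R := fun z =>
  (1 - disc M) * pi z.1 z.2
  * limn (fun n => \sum_(0 <= t < n) disc M ^+ t * state_prob pi t z.1).

Definition bellman : set (S * A -> R) :=
  [set rho | (forall z, 0 <= rho z) /\
    forall s', \sum_a' rho (s', a')
      = (1 - disc M) * init M s' + disc M * \sum_z trans M z.1 z.2 s' * rho z].

(* The convention 0 log 0 = 0 holds: occupancy pi z has the factor pi z.1 z.2. *)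
Definition causal_entropy pi : R :=
  (1 - disc M)^-1 * \sum_z occupancy pi z * (- ln (pi z.1 z.2)).

Definition entropic_rl_value c : R :=
  minimum [set - causal_entropy pi + pairing c (occupancy pi)
          | pi in policies].

Definition irl (psi : (S * A -> R) -> R) (piE : S -> A -> R) :
    set (S * A -> R) :=
  argmax (fun c =>
    - psi c + entropic_rl_value c - pairing c (occupancy piE)).

Definition wasserstein_regularizer (d : S * A -> S * A -> R)
    (piE : S -> A -> R) c : R :=
  sup [set pairing c (rho \- occupancy piE)
           - wasserstein d rho (occupancy piE) | rho in bellman].

End MDP.

(* Main.v *)
Require Import Defs.
From mathcomp Require Import ring lra.

Set Implicit Arguments.
Unset Strict Implicit.
Unset Printing Implicit Defensive.

Local Open Scope classical_set_scope.
Local Open Scope ring_scope.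

(** The value psi(c) is nonpositive as soon as c is 1-Lipschitz, since then
<c, rho - rho_E> <= W_d(rho, rho_E); so Kantorovich-Rubinstein duality bounds
psi^*(rho - rho_E) from below by W_d(rho, rho_E), while the upper bound is
the choice of rho in the supremum defining psi.  Attainment of the transport
minimum and duality both come from Farkas' lemma, applied to the linear system
saying that a coupling has a prescribed cost; a pair of dual potentials is made
Lipschitz by a c-transform.  The second identity only moves
<c, rho_E> through the supremum defining psi. *)

(** * Farkas' lemma for finitely many linear forms *)

(* Bartl's induction: if [a k] is really needed, [x0] violates [b] only because
   of [a k], and precomposing with the projection onto the kernel of [a k] along
   [x0] removes one form. *)
Lemma farkas (R : realFieldType) (V : lmodType R) (J : eqType) (s : seq J)
    (a : J -> V -> R) (b : V -> R) :
  uniq s -> (forall j, scalar (a j)) -> scalar b ->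
  (forall x, (forall j, j \in s -> a j x <= 0) -> b x <= 0) ->
  exists2 l : J -> R, forall j, 0 <= l j &
    forall x, b x = \sum_(j <- s) l j * a j x.
Proof.
elim: s a b => [|k s IHs] a b /=.
  move=> _ _ b_lin b_le0; exists (fun=> 0) => // x; rewrite big_nil.
  have b0 : b 0 = 0 by have := b_lin (-1) 0 0; rewrite scaler0 addr0; lra.
  have bN : b (- x) = - b x.
    by have := b_lin (-1) x 0; rewrite addr0 scaleN1r b0; lra.
  have := b_le0 (- x) (fun _ => ltac:(by [])); have := b_le0 x (fun _ => ltac:(by [])).
  by rewrite bN; lra.
move=> /andP[ks us] a_lin b_lin b_le0.
(* Since [k] is not in [s], its multiplier can be chosen freely without changing the sum over
   [s]. *)
have sum_upd l e x : \sum_(j <- s) (if j == k then e else l j) * a j x =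
    \sum_(j <- s) l j * a j x.
  apply: eq_big_seq => j js; case: eqP => // jk.
  by move: ks; rewrite -jk js.
have [b_s|/existsNP[x0 /not_implyP[a_x0 /negP]]] :=
    pselect (forall x, (forall j, j \in s -> a j x <= 0) -> b x <= 0).
  have [l l0 lE] := IHs a b us a_lin b_lin b_s.
  exists (fun j => if j == k then 0 else l j) => [j|x]; first by case: eqP.
  by rewrite big_cons eqxx mul0r add0r sum_upd.
rewrite -ltNge => b_x0.
have ak_x0 : 0 < a k x0.
  rewrite ltNge; apply/negP => ak_x0.
  suff : b x0 <= 0 by rewrite leNgt b_x0.
  by apply: b_le0 => j; rewrite inE => /predU1P[->//|]; exact: a_x0.
pose y x := - (a k x / a k x0) *: x0 + x.
have yE f : scalar f -> forall x, f (y x) = f x - a k x / a k x0 * f x0.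
  by move=> f_lin x; rewrite /y f_lin; ring.
have y_scalar f : scalar f -> scalar (f \o y).
  move=> f_lin t u v /=; rewrite !yE// f_lin a_lin; field.
  by rewrite gt_eqF.
have [l l0 lE] : exists2 l : J -> R, forall j, 0 <= l j &
    forall x, b (y x) = \sum_(j <- s) l j * a j (y x).
  apply: (IHs (fun j => a j \o y) (b \o y)) => //.
  - by move=> j; exact: y_scalar.
  - exact: y_scalar.
  - move=> x ax; apply: b_le0 => j; rewrite inE => /predU1P[->|]; last exact: ax.
    by rewrite yE// divfK ?subrr// gt_eqF.
(* Expanding [lE] through the projection [y] leaves exactly this coefficient on [a k x]; it is
   nonnegative because [b x0 > 0] while every other [a j x0 <= 0]. *)
pose e := (b x0 - \sum_(j <- s) l j * a j x0) / a k x0.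
have e0 : 0 <= e.
  apply: divr_ge0; last exact: ltW.
  rewrite subr_ge0 (le_trans _ (ltW b_x0))//.
  rewrite big_seq sumr_le0// => j js.
  by rewrite mulr_ge0_le0// a_x0.
exists (fun j => if j == k then e else l j) => [j|x]; first by case: eqP.
rewrite big_cons eqxx sum_upd.
have := lE x; rewrite yE//.
under eq_bigr do rewrite yE// mulrBr mulrCA.
rewrite sumrB -mulr_sumr /e => /eqP; rewrite subr_eq => /eqP ->.
by field; rewrite gt_eqF.
Qed.

(** * Optimal transport on a finite set: attainment and duality *)

Definition transport_cost (R : realType) (T : finType) (d k : T -> T -> R) : R :=
  \sum_x \sum_y d x y * k x y.

Lemma pairing_delta (R : realType) (T : finType) (x : T) (F : T -> R) :
  pairing (fun z => (z == x)%:R) F = F x.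
Proof.
rewrite /pairing (bigD1 x)//= eqxx mul1r big1 ?addr0// => z /negbTE->.
by rewrite mul0r.
Qed.

Lemma pairing0 (R : realType) (T : finType) (F : T -> R) :
  pairing (fun=> 0) F = 0.
Proof. by rewrite /pairing big1// => z _; rewrite mul0r. Qed.

Section Transport.
Context (R : realType) (T : finType) (d : T -> T -> R) (mu nu : T -> R).

(** Farkas' lemma on the space of triples [(f, g, t)], with one form per pair [(x, y)]: the
    nonnegative multipliers are the entries of a coupling, and a violating triple is the certificate
    on the right. The sign of [t] is free because the cost is prescribed exactly. *)
Lemma transport_alternative (v : R) :
  (exists2 k, couplings mu nu k & transport_cost d k = v) \/
  exists f g t, (forall x y, f x + g y + t * d x y <= 0) /\
    0 < pairing f mu + pairing g nu + t * v.
Proof.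
pose V : lmodType R := ((T -> R) * (T -> R) * R^o)%type.
pose a (z : T * T) (w : V) : R := w.1.1 z.1 + w.1.2 z.2 + w.2 * d z.1 z.2.
pose b (w : V) : R := pairing w.1.1 mu + pairing w.1.2 nu + w.2 * v.
have [H|] := pselect (forall w, (forall z, a z w <= 0) -> b w <= 0); last first.
  move=> /existsNP[[[f g] t]] /not_implyP[aw /negP]; rewrite -ltNge => bw.
  by right; exists f, g, t; split=> // x y; have := aw (x, y).
left.
have pairingP (c : R) (f g h : T -> R) :
    pairing (c *: f + g) h = c * pairing f h + pairing g h.
  rewrite /pairing mulr_sumr -big_split; apply: eq_bigr => z _ /=.
  by rewrite -[(_ + _) z]/(c * f z + g z) mulrDl mulrA.
have a_lin z : scalar (a z).
  move=> c u w; rewrite /a /=.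
  rewrite -[(_ + _) z.1]/(c * u.1.1 z.1 + w.1.1 z.1).
  rewrite -[(_ + _) z.2]/(c * u.1.2 z.2 + w.1.2 z.2).
  rewrite -[_ *: _]/(c * u.2); ring.
have b_lin : scalar b.
  move=> c u w; rewrite /b /= !pairingP -[_ *: _]/(c * u.2); ring.
have [l l0 lE] : exists2 l : T * T -> R, forall j, 0 <= l j &
    forall x, b x = \sum_(j <- index_enum _) l j * a j x.
  apply: farkas => // [|w aw]; first exact: index_enum_uniq.
  by apply: H => z; apply: aw; exact: mem_index_enum.
have bE w : b w = \sum_x \sum_y a (x, y) w * l (x, y).
  by rewrite lE pair_bigA; apply: eq_bigr => -[x y] _; rewrite mulrC.
(* Indicator functions in the first or second slot of [bE] read off the two marginals, and the
   triple [(0, 0, 1)] reads off the cost. *)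
exists (fun x y => l (x, y)).
  split=> [//|x|y].
  - have := bE ((fun z => (z == x)%:R), (fun=> 0), 0).
    rewrite {1}/b /= pairing_delta pairing0 mul0r !addr0 => ->.
    under [RHS]eq_bigr do under eq_bigr do rewrite /a /= mul0r !addr0.
    under [RHS]eq_bigr do rewrite -mulr_sumr.
    by rewrite -/(pairing _ _) pairing_delta.
  - have := bE ((fun=> 0), (fun z => (z == y)%:R), 0).
    rewrite {1}/b /= pairing_delta pairing0 mul0r add0r addr0 => ->.
    apply: eq_bigr => x _.
    under [RHS]eq_bigr do rewrite /a /= mul0r addr0 add0r.
    by rewrite -/(pairing _ _) pairing_delta.
have := bE ((fun=> 0), (fun=> 0), 1).
rewrite {1}/b /= !pairing0 !add0r mul1r => ->.
apply: eq_bigr => x _; apply: eq_bigr => y _.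
by rewrite /a /= !add0r mul1r.
Qed.

Hypotheses (d_ge0 : forall x y, 0 <= d x y).
Hypotheses (mu_prob : is_prob mu) (nu_prob : is_prob nu).

Let costs := transport_cost d @` couplings mu nu.

Lemma couplings_prod : couplings mu nu (fun x y => mu x * nu y).
Proof.
have [mu0 mu1] := mu_prob; have [nu0 nu1] := nu_prob; split=> [x y|x|y].
- by rewrite mulr_ge0.
- by rewrite -mulr_sumr nu1 mulr1.
- by rewrite -mulr_suml mu1 mul1r.
Qed.

(** Weak duality: the pointwise inequality is integrated against [k], whose marginals turn the first
    two terms into pairings with [mu] and [nu]. *)
Lemma dual_le_transport_cost (k : T -> T -> R) (f g : T -> R) (t : R) :
  couplings mu nu k -> (forall x y, f x + g y + t * d x y <= 0) ->
  pairing f mu + pairing g nu + t * transport_cost d k <= 0.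
Proof.
move=> [k0 k1 k2] fg.
have -> : pairing f mu = \sum_x \sum_y f x * k x y.
  by apply: eq_bigr => x _; rewrite -mulr_sumr k1.
have -> : pairing g nu = \sum_x \sum_y g y * k x y.
  by rewrite exchange_big; apply: eq_bigr => y _; rewrite -mulr_sumr k2.
rewrite /transport_cost mulr_sumr -!big_split sumr_le0// => x _ /=.
rewrite mulr_sumr -!big_split sumr_le0// => y _ /=.
by rewrite mulrA -!mulrDl mulr_le0_ge0.
Qed.

Lemma has_inf_costs : has_inf costs.
Proof.
split; first by eexists; eexists; [exact: couplings_prod|].
exists 0 => _ [k [k0 _ _] <-].
by apply: sumr_ge0 => x _; apply: sumr_ge0 => y _; rewrite mulr_ge0.
Qed.

(** If no coupling had cost [inf costs], a certificate would exist there; weak duality turns it into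
    a lower bound [- D / t] of all costs that lies strictly above their infimum. *)
Lemma inf_costs_attained :
  exists2 k, couplings mu nu k & transport_cost d k = inf costs.
Proof.
have [//|[f [g [t [fg]]]]] := transport_alternative (inf costs).
set D := (_ + pairing g nu) => D_gt0.
have infc := has_inf_costs.
have costs_gap k : couplings mu nu k -> D + t * transport_cost d k <= 0.
  by move=> kc; exact: dual_le_transport_cost.
(* For [t >= 0] the product coupling, of cost at least the infimum, would contradict the strict
   inequality of the certificate. *)
have t_lt0 : t < 0.
  rewrite ltNge; apply/negP => t0.
  have := costs_gap _ couplings_prod.
  have : inf costs <= transport_cost d (fun x y => mu x * nu y).
    by apply: ge_inf; [exact: infc.2|eexists; [exact: couplings_prod|]].
  by move=> /(ler_wpM2l t0); lra.
have : - D / t <= inf costs.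
  apply: lb_le_inf; first exact: infc.1.
  move=> _ [k /costs_gap kc <-]; rewrite ler_ndivrMr// mulrC; lra.
by rewrite ler_ndivrMr// mulrC; lra.
Qed.

Lemma wasserstein_inf : wasserstein d mu nu = inf costs.
Proof.
have [k kc kE] := inf_costs_attained.
have lb : lbound costs (inf costs).
  by move=> x cx; apply: ge_inf => //; exact: has_inf_costs.2.
have in_costs : costs (inf costs) by exists k.
rewrite /wasserstein /minimum.
(* The default branch of [xget] is excluded, since [inf costs] is itself a least element. *)
case: xgetP => [_ -> [xc xlb]|/(_ (inf costs))[]//].
by apply/eqP; rewrite eq_le lb// xlb.
Qed.

Lemma wasserstein_attained :
  exists2 k, couplings mu nu k & transport_cost d k = wasserstein d mu nu.
Proof. by rewrite wasserstein_inf; exact: inf_costs_attained. Qed.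

Lemma wasserstein_ge0 : 0 <= wasserstein d mu nu.
Proof.
have [k [k0 _ _] <-] := wasserstein_attained.
by apply: sumr_ge0 => x _; apply: sumr_ge0 => y _; rewrite mulr_ge0.
Qed.

Lemma pairing_diff_le_wasserstein (c : T -> R) :
  (forall x y, c x - c y <= d x y) ->
  pairing c mu - pairing c nu <= wasserstein d mu nu.
Proof.
move=> c_lip; have [k kc <-] := wasserstein_attained.
have c_le0 x y : c x + (\- c) y + -1 * d x y <= 0.
  by have := c_lip x y; rewrite /=; lra.
have := dual_le_transport_cost kc c_le0.
have -> : pairing (\- c) nu = - pairing c nu.
  by rewrite /pairing -sumrN; apply: eq_bigr => x _; rewrite mulNr.
lra.
Qed.

(** No coupling costs less than the infimum, so the alternative at [v] yields a certificate.
    Comparison with an optimal coupling forces [t < 0], and division by [- t] normalizes the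
    coefficient of [d] to -1. *)
Lemma wasserstein_dual_approx (v : R) : v < wasserstein d mu nu ->
  exists f g, (forall x y, f x + g y <= d x y) /\ v < pairing f mu + pairing g nu.
Proof.
rewrite wasserstein_inf => v_lt.
have [[k kc kE]|[f [g [t [fg fg_gt0]]]]] := transport_alternative v.
  have : inf costs <= v by apply: ge_inf; [exact: has_inf_costs.2|exists k].
  lra.
have [k kc kE] := inf_costs_attained.
have := dual_le_transport_cost kc fg; rewrite kE => fg_le0.
have t_lt0 : t < 0.
  rewrite ltNge; apply/negP => t0.
  by have := ler_wpM2l t0 (ltW v_lt); lra.
pose n (h : T -> R) : T -> R := fun x => h x / - t.
have nE h m : pairing (n h) m = pairing h m / - t.
  by rewrite /pairing mulr_suml; apply: eq_bigr => x _; rewrite mulrAC.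
exists (n f), (n g); rewrite !nE -mulrDl; split=> [x y|].
  by rewrite /n -mulrDl ler_pdivrMr ?oppr_gt0//; have := fg x y; lra.
by rewrite ltr_pdivlMr ?oppr_gt0//; lra.
Qed.

End Transport.

(** The c-transform lies above [f] by admissibility and below [- g] because [d x x = 0], so it loses
    nothing in the dual value; the triangle inequality makes it Lipschitz. *)
Lemma kantorovich_rubinstein_approx (R : realType) (T : finType)
    (d : T -> T -> R) (mu nu : T -> R) (v : R) :
  is_metric d -> is_prob mu -> is_prob nu -> v < wasserstein d mu nu ->
  exists2 c : T -> R, forall x y, c x - c y <= d x y &
    v < pairing c mu - pairing c nu.
Proof.
move=> [d0 deq _ d_tri] mu_prob nu_prob.
move=> /(wasserstein_dual_approx d0 mu_prob nu_prob)[f [g [fg v_lt]]].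
(* The minimum below needs an initial value, taken at a point [x0]; one exists because [mu] has mass
   1. *)
case: (pickP T) => [x0 _|T0]; last first.
  have := mu_prob.2; rewrite big1 => [/eqP|x]; last by have := T0 x.
  by rewrite eq_sym oner_eq0.
(* the c-transform of [g] *)
pose c x := \big[Order.min/d x x0 - g x0]_y (d x y - g y).
have c_le x y : c x <= d x y - g y by exact: bigmin_le_cond.
have le_c x r : (forall y, r <= d x y - g y) -> r <= c x.
  by move=> H; apply: le_bigmin.
exists c => [x y|].
  rewrite lerBlDr -lerBlDl; apply: le_c => z.
  by have := c_le x z; have := d_tri x y z; lra.
have f_c : pairing f mu <= pairing c mu.
  apply: ler_sum => x _; rewrite ler_wpM2r ?mu_prob.1//; apply: le_c => y.
  by have := fg x y; lra.
have g_c : pairing g nu <= - pairing c nu.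
  rewrite /pairing -sumrN; apply: ler_sum => x _.
  rewrite -mulNr ler_wpM2r ?nu_prob.1//.
  by have := c_le x x; rewrite (deq x x).2//; lra.
lra.
Qed.

(** * Trajectories, occupancy measures and the Bellman equation *)

(** The analogue of [rcons] for finite functions: trajectories are split at their last step, where
    the Markov property applies. *)
Definition ffun_rcons (Z : Type) (n : nat) (h : {ffun 'I_n -> Z}) (z : Z) :
    {ffun 'I_n.+1 -> Z} :=
  [ffun i => if unlift ord_max i is Some j then h j else z].

Lemma ffun_rcons_widen (Z : Type) (n : nat) (h : {ffun 'I_n -> Z}) (z : Z) i :
  ffun_rcons h z (widen_ord (leqnSn n) i) = h i.
Proof.
rewrite ffunE (_ : widen_ord _ _ = lift ord_max i) ?liftK//.
by apply: val_inj; rewrite /= /bump leqNgt ltn_ord.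
Qed.

Lemma ffun_rcons_max (Z : Type) (n : nat) (h : {ffun 'I_n -> Z}) (z : Z) :
  ffun_rcons h z ord_max = z.
Proof. by rewrite ffunE unlift_none. Qed.

Lemma sum_ffun_rcons (R : nmodType) (Z : finType) (n : nat)
    (F : {ffun 'I_n.+1 -> Z} -> R) :
  \sum_h F h = \sum_h \sum_z F (ffun_rcons h z).
Proof.
rewrite pair_bigA (reindex (fun p => ffun_rcons p.1 p.2))//=.
exists (fun h : {ffun 'I_n.+1 -> Z} =>
    ([ffun j => h (widen_ord (leqnSn n) j)], h ord_max)) => [[h z]|h] _ /=.
  rewrite ffun_rcons_max; congr pair; apply/ffunP => j.
  by rewrite ffunE ffun_rcons_widen.
apply/ffunP => i; rewrite ffunE; case: unliftP => [j ->|->//].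
by rewrite ffunE; congr (h _); apply: val_inj; rewrite /= /bump leqNgt ltn_ord.
Qed.

Section Occupancy.
Context (R : realType) (S A : finType) (M : mdp R S A) (pi : S -> A -> R).
Hypothesis pi_policy : policies pi.

Let gamma := disc M.

Lemma traj_prob_rcons t (h : {ffun 'I_t.+1 -> S * A}) z :
  traj_prob M pi (ffun_rcons h z) =
  traj_prob M pi h * (trans M (h ord_max).1 (h ord_max).2 z.1 * pi z.1 z.2).
Proof.
rewrite /traj_prob [X in _ * X * _]big_ord_recr [X in _ * _ * X]big_ord_recr /=.
have -> : ffun_rcons h z ord0 = h ord0.
  by rewrite -[RHS](ffun_rcons_widen h z); congr (ffun_rcons h z _); apply: val_inj.
rewrite ffun_rcons_max ffun_rcons_widen.
have -> : lift ord0 (ord_max : 'I_t.+1) = ord_max by apply: val_inj.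
rewrite ffun_rcons_max.
under eq_bigr do rewrite ffun_rcons_widen.
under [X in _ * _ * (X * _)]eq_bigr => i _.
  rewrite ffun_rcons_widen.
  have -> : lift ord0 (widen_ord (leqnSn t) i) =
    widen_ord (leqnSn t.+1) (lift ord0 i) by apply: val_inj.
  rewrite ffun_rcons_widen; over.
ring.
Qed.

Lemma sum_policy s : \sum_a pi s a = 1.
Proof. by have [] := pi_policy s. Qed.

(** Forward Kolmogorov recursion for the law of the state at time [t], replacing the sum over whole
    trajectories. *)
Fixpoint state_marginal t : S -> R :=
  if t is u.+1 then fun s' =>
    \sum_z trans M z.1 z.2 s' * (state_marginal u z.1 * pi z.1 z.2)
  else init M.

Lemma state_marginalS t s : state_marginal t.+1 s =
  \sum_z trans M z.1 z.2 s * (state_marginal t z.1 * pi z.1 z.2).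
Proof. by []. Qed.

(** [F] is arbitrary because summing out the last pair replaces it by its one-step conditional
    expectation, a function of the preceding pair to which the induction hypothesis applies. *)
Lemma expectation_traj_prob t (F : S * A -> R) :
  \sum_(h : {ffun 'I_t.+1 -> S * A}) traj_prob M pi h * F (h ord_max) =
  \sum_z state_marginal t z.1 * pi z.1 z.2 * F z.
Proof.
elim: t F => [|t IHt] F.
  rewrite (reindex (fun z : S * A => [ffun=> z])) /=; last first.
    exists (fun h : {ffun 'I_1 -> S * A} => h ord0) => [z|h] _.
      by rewrite ffunE.
    by apply/ffunP => i; rewrite ffunE (ord1 i).
  apply: eq_bigr => z _; congr (_ * _).
    by rewrite /traj_prob big_ord1 big_ord0 !ffunE mulr1.
  by rewrite ffunE.
rewrite sum_ffun_rcons.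
under eq_bigr => h _.
  under eq_bigr do rewrite traj_prob_rcons ffun_rcons_max -mulrA.
  rewrite -mulr_sumr; over.
rewrite (IHt (fun w =>
  \sum_z trans M w.1 w.2 z.1 * pi z.1 z.2 * F z)) /=.
under eq_bigr do rewrite mulr_sumr.
rewrite exchange_big; apply: eq_bigr => z _ /=; rewrite !mulr_suml.
by apply: eq_bigr => w _; ring.
Qed.

Lemma state_probE t s : state_prob M pi t s = state_marginal t s.
Proof.
rewrite /state_prob big_mkcond.
under eq_bigr do rewrite -mulrb -mulr_natr.
rewrite (expectation_traj_prob t (fun z => (z.1 == s)%:R)).
rewrite -(pair_bigA _ (fun s' a => state_marginal t s' * pi s' a * (s' == s)%:R)) /=.
under eq_bigr do rewrite -mulr_suml -mulr_sumr sum_policy mulr1.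
rewrite (bigD1 s)//= eqxx mulr1 big1 ?addr0// => s' /negbTE->.
by rewrite mulr0.
Qed.

Lemma state_marginal_ge0 t s : 0 <= state_marginal t s.
Proof.
elim: t s => [|t IHt] s /=; first exact: (init_prob M).1.
apply: sumr_ge0 => z _; rewrite mulr_ge0 ?(trans_prob M z.1 z.2).1//.
by rewrite mulr_ge0// (pi_policy z.1).1.
Qed.

Lemma sum_state_marginal t : \sum_s state_marginal t s = 1.
Proof.
elim: t => [|t IHt] /=; first exact: (init_prob M).2.
rewrite exchange_big /=.
under eq_bigr do rewrite -mulr_suml (trans_prob M _ _).2 mul1r.
rewrite -(pair_bigA _ (fun s a => state_marginal t s * pi s a)) /=.
by under eq_bigr do rewrite -mulr_sumr sum_policy mulr1.
Qed.

Lemma state_marginal_le1 t s : state_marginal t s <= 1.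
Proof.
rewrite -(sum_state_marginal t) (bigD1 s)//= lerDl.
by apply: sumr_ge0 => s' _; exact: state_marginal_ge0.
Qed.

Let discounted s n := \sum_(0 <= t < n) gamma ^+ t * state_prob M pi t s.

Lemma is_cvg_discounted s : cvgn (discounted s).
Proof.
have /andP[g0 g1] := disc_gt0_lt1 M.
apply: (@series_le_cvg _ _ (geometric 1 gamma)) => [n|n|n|].
- by rewrite state_probE mulr_ge0 ?state_marginal_ge0// exprn_ge0// ltW.
- by rewrite /= mul1r exprn_ge0// ltW.
- rewrite /= mul1r state_probE ler_piMr ?state_marginal_le1//.
  by rewrite exprn_ge0// ltW.
- by apply: is_cvg_geometric_series; rewrite ger0_norm// ltW.
Qed.

(** The term at time 0 gives [init M s], and one forward step in each later term releases a factor
    [gamma]. In the limit, after multiplication by [1 - gamma], this is the Bellman equation. *)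
Lemma discountedS s n : discounted s n.+1 =
  init M s + gamma * \sum_z trans M z.1 z.2 s * pi z.1 z.2 * discounted z.1 n.
Proof.
rewrite /discounted big_nat_recl// expr0 mul1r state_probE; congr (_ + _).
under [in RHS]eq_bigr do rewrite mulr_sumr.
rewrite exchange_big mulr_sumr; apply: eq_bigr => t _ /=.
rewrite exprS -mulrA; congr (_ * _); rewrite state_probE state_marginalS mulr_sumr.
by apply: eq_bigr => z _; rewrite state_probE; ring.
Qed.

Lemma lim_discountedE s : limn (discounted s) =
  init M s + gamma * \sum_z trans M z.1 z.2 s * pi z.1 z.2 * limn (discounted z.1).
Proof.
have dS : discounted s n.+1 @[n --> \oo] --> limn (discounted s).
  by rewrite (cvg_shiftS (discounted s)); exact: is_cvg_discounted.
suff dS' : discounted s n.+1 @[n --> \oo] --> init M s + gamma *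
    \sum_z trans M z.1 z.2 s * pi z.1 z.2 * limn (discounted z.1).
  exact: cvg_unique dS dS'.
under eq_cvg do rewrite discountedS.
apply: cvgD; first exact: cvg_cst.
apply: cvgMl_tmp; apply: cvg_big => [|z _]; first exact: add_continuous.
apply: cvgMl_tmp; exact: is_cvg_discounted.
Qed.

Lemma occupancy_bellman : bellman M (occupancy M pi).
Proof.
have /andP[g0 g1] := disc_gt0_lt1 M.
split=> [z|s].
  rewrite /occupancy mulr_ge0//.
    by apply: mulr_ge0; [rewrite subr_ge0 ltW|exact: (pi_policy z.1).1].
  apply: limr_ge; first exact: is_cvg_discounted.
  apply: nearW => n; apply: sumr_ge0 => t _.
  by rewrite state_probE mulr_ge0 ?state_marginal_ge0// exprn_ge0// ltW.
rewrite /occupancy /= -mulr_suml -mulr_sumr sum_policy mulr1.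
rewrite -/(discounted s) lim_discountedE mulrDr; congr (_ + _).
rewrite mulrCA; congr (_ * _); rewrite mulr_sumr; apply: eq_bigr => z _.
by rewrite -/(discounted z.1); ring.
Qed.
End Occupancy.

(** Summing the Bellman equation over all states gives [m = 1 - gamma + gamma * m] for the total
    mass [m], and [gamma < 1] forces [m = 1]. *)
Lemma bellman_prob (R : realType) (S A : finType) (M : mdp R S A)
    (rho : S * A -> R) : bellman M rho -> is_prob rho.
Proof.
move=> [rho0 rhoB]; split=> //.
have /andP[_ g1] := disc_gt0_lt1 M.
have : \sum_z rho z = 1 - disc M + disc M * \sum_z rho z.
  transitivity (\sum_s \sum_a rho (s, a)).
    by rewrite pair_bigA; apply: eq_bigr => -[].
  under eq_bigr do rewrite rhoB.
  rewrite big_split /= -!mulr_sumr (init_prob M).2 mulr1; congr (_ + _ * _).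
  rewrite exchange_big /=; apply: eq_bigr => z _.
  by rewrite -mulr_suml (trans_prob M _ _).2 mul1r.
set m := \sum_z _ => mE; have : (1 - disc M) * (m - 1) = 0 by lra.
by move=> /eqP; rewrite mulf_eq0 !subr_eq0 (gt_eqF g1) /= => /eqP.
Qed.

Lemma pairingBr (R : realType) (T : finType) (c mu nu : T -> R) :
  pairing c (mu \- nu) = pairing c mu - pairing c nu.
Proof. by rewrite /pairing -sumrB; apply: eq_bigr => z _; rewrite mulrBr. Qed.

Lemma pairing_prob_le (R : realType) (T : finType) (c mu : T -> R) :
  is_prob mu -> pairing c mu <= \sum_z `|c z|.
Proof.
move=> [mu0 mu1]; apply: ler_sum => z _.
have mu_le1 : mu z <= 1.
  by rewrite -mu1 (bigD1 z)//= lerDl; apply: sumr_ge0.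
apply: le_trans (ler_norm _) _; rewrite normrM (ger0_norm (mu0 z)).
exact: ler_piMr.
Qed.

(** * The Wasserstein regularizer and its conjugate *)

Section Regularizer.
Context (R : realType) (S A : finType) (M : mdp R S A).
Context (d : S * A -> S * A -> R) (piE : S -> A -> R).
Hypotheses (d_metric : is_metric d) (piE_policy : policies piE).

Let rhoE := occupancy M piE.
Let psi := wasserstein_regularizer M d piE.
Let W rho := wasserstein d rho rhoE.

Let d_ge0 : forall x y, 0 <= d x y.
Proof. by case: d_metric. Qed.

Let rhoE_prob : is_prob rhoE.
Proof. exact/bellman_prob/occupancy_bellman. Qed.

Lemma wasserstein_bellman_ge0 rho : bellman M rho -> 0 <= W rho.
Proof. by move=> /bellman_prob rho_prob; exact: wasserstein_ge0. Qed.

Lemma le_regularizer c rho : bellman M rho ->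
  pairing c rho - pairing c rhoE - W rho <= psi c.
Proof.
move=> rhoB; rewrite -pairingBr; apply: ub_le_sup; last by exists rho.
(* Boundedness makes the real [sup] an upper bound: Bellman solutions are probabilities, so their
   pairing with [c] is at most the sum of the absolute values, and [W] is nonnegative. *)
exists (\sum_z `|c z| - pairing c rhoE) => _ [r rB <-].
rewrite pairingBr.
have := wasserstein_bellman_ge0 rB; rewrite /W.
have := pairing_prob_le c (bellman_prob rB).
by rewrite -/rhoE; lra.
Qed.

Lemma regularizer_le c b :
  (forall rho, bellman M rho -> pairing c rho - pairing c rhoE - W rho <= b) ->
  psi c <= b.
Proof.
move=> c_le; apply: ge_sup.
  (* The expert occupancy itself solves the Bellman equation, so the supremum is over a nonempty
     set. *)
  by eexists; exists rhoE => //; exact: occupancy_bellman.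
by move=> _ [rho rhoB <-]; rewrite pairingBr; exact: c_le.
Qed.

Lemma conjugate_regularizer rho : bellman M rho ->
  conjugate psi (rho \- rhoE) = (W rho)%:E.
Proof.
move=> rhoB; apply/eqP; rewrite eq_le; apply/andP; split.
  apply: ge_ereal_sup => _ [c _ <-]; rewrite lee_fin pairingBr.
  by have := le_regularizer c rhoB; lra.
(* The conjugate is a supremum, so duality up to every [e > 0] suffices and no optimal potential is
   needed. *)
apply/lee_subgt0Pr => e e0.
have [|c c_lip cW] := kantorovich_rubinstein_approx (v := W rho - e) d_metric
  (bellman_prob rhoB) rhoE_prob; first by rewrite ltrBlDr ltrDl.
(* [psi] is nonpositive at every 1-Lipschitz cost *)
have psi_le0 : psi c <= 0.
  apply: regularizer_le => r /bellman_prob r_prob.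
  by rewrite subr_le0; exact: pairing_diff_le_wasserstein.
apply: (@le_trans _ _ (pairing c (rho \- rhoE) - psi c)%:E).
  by rewrite -EFinB lee_fin pairingBr; lra.
by apply: ereal_sup_ubound; exists c.
Qed.

(** Up to the constant [pairing c rhoE], the objective is the negative of the one defining [psi], so
    the supremum becomes an infimum; [le_regularizer] also bounds it from below. *)
Lemma inf_wasserstein_regularizer c :
  inf [set W rho - pairing c rho | rho in bellman M] =
  - psi c - pairing c rhoE.
Proof.
apply/eqP; rewrite eq_le; apply/andP; split.
  rewrite lerBrDr lerNr; apply: regularizer_le => rho rhoB.
  have : inf [set W r - pairing c r | r in bellman M] <= W rho - pairing c rho.
    apply: ge_inf; last by exists rho.
    exists (- psi c - pairing c rhoE) => _ [r rB <-].
    by have := le_regularizer c rB; lra.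
  lra.
apply: lb_le_inf.
  by eexists; exists rhoE => //; exact: occupancy_bellman.
by move=> _ [r rB <-]; have := le_regularizer c rB; lra.
Qed.

End Regularizer.

Theorem proposition3p2 (R : realType) (S A : finType) (M : mdp R S A)
    (d : S * A -> S * A -> R) (hd : is_metric d)
    (piE : S -> A -> R) (hpiE : policies piE) :
  let rhoE := occupancy M piE in
  let psi := wasserstein_regularizer M d piE in
  (forall pi : S -> A -> R, policies pi ->
     conjugate psi (occupancy M pi \- rhoE)
     = (wasserstein d (occupancy M pi) rhoE)%:E)
  /\
  irl M psi piE
  = argmax (fun c : S * A -> R =>
      inf [set wasserstein d rho rhoE - pairing c rho | rho in bellman M]
      + entropic_rl_value M c).
Proof.
split=> [pi pi_policy|].
  by apply: conjugate_regularizer => //; exact: occupancy_bellman.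
(* The two objectives agree at every cost [c], not only at their maximizers. *)
congr argmax; apply/funext => c.
by rewrite inf_wasserstein_regularizer// addrAC.
Qed.
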